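(* There is a $64\,CCZ\to8\,CCZ$ distillation protocol at distance $4$. Precisely, let $E$ be any one of the three sets $$\{(1,2),(1,5),(2,5),(2,6),(4,2),(4,6),(5,1),(5,5)\},$$ $$\{(1,3),(2,2),(2,4),(3,1),(3,4),(4,2),(4,3),(4,4)\},$$ $$\{(1,5),(2,1),(2,4),(5,1),(5,2),(5,5),(6,2),(6,4)\},$$ and let $G\in\mathbb F_8^{13\times64}$ have columns indexed by $(x,y)\in\mathbb F_8^2$ and rows the evaluations of the eight monomials $x^ay^b$, $(a,b)\in E$ (logical rows), followed by the evaluations of $1,x,y,x^2,y^2$ (stabilizer rows). Then $G$ has full rank and satisfies $$\sum_i(g_{a,i})^4(g_{b,i})^2g_{c,i}=\begin{cases}1&1\le a=b=c\le8\\0&\text{otherwise}\end{cases}\qquad(1\le a,b,c\le13);$$ consequently applying the norm gate $N$ ($CCZ$ up to Paulis) to each of the 64 physical qudits acts on the code as the logical $N^{\otimes8}$; and the $Z$-distance of the code is $4$.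
   Context: An $\mathbb F_8$-qudit, with basis $|\gamma\rangle$, $\gamma\in\mathbb F_8$, is identified with three qubits via an $\mathbb F_2$-basis of $\mathbb F_8$. The norm gate is $N|\gamma\rangle=(-1)^{\gamma^7}|\gamma\rangle$ ($\gamma^7\in\{0,1\}$); up to global phase it equals $X^{\otimes3}\,CCZ\,X^{\otimes3}$. A full-rank matrix $G\in\mathbb F_8^{m\times n}$ with rows $\mathbf g_1,\dots,\mathbf g_m$ and $k$ logical rows defines a CSS code on $n$ qudits: the first $k$ rows are $X$-logical operators, the remaining rows generate the $X$-stabilizer space $\mathcal G_0$; logical basis states are $|\overline u\rangle\propto\sum_{\mathbf g\in\mathcal G_0}|\sum_{a\le k}u_a\mathbf g_a+\mathbf g\rangle$. ''Acts as the logical $N^{\otimes k}$'' means $N^{\otimes n}|\overline u\rangle=(-1)^{\sum_{a\le k}u_a^7}|\overline u\rangle$ for all $u\in\mathbb F_8^k$. The $Z$-distance is the minimum Hamming weight over $\mathbb F_8$ of a vector orthogonal (for $\sum x_iy_i$) to all stabilizer rows but not to at least one logical row. *)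

(* Defs.v *)
From HB Require Import structures.
From mathcomp Require Import all_boot all_order all_algebra.

Set Implicit Arguments.
Unset Strict Implicit.
Unset Printing Implicit Defensive.

Import GRing.Theory Num.Theory.

Local Open Scope ring_scope.

(* The scalars are an arbitrary numClosedFieldType C (the complex numbers     *)
(* being an instance).  A register with label set X (a finType) has           *)
(* computational basis |x>, x : X; n qudits with label set Q form the         *)
(* register with label set 'rV[Q]_n.                                          *)
Section Registers.
Variable C : numClosedFieldType.

Definition state (X : finType) := {ffun X -> C^o}.

Definition ket (X : finType) (x : X) : state X := [ffun y => (y == x)%:R].

(* Operators are given by their matrix elements A x y = <x|A|y>. *)
Definition operator (X : finType) := X -> X -> C.

Definition applyop (X : finType) (A : operator X) (psi : state X) : state X :=
  [ffun x => \sum_(y : X) A x y * psi y].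

Definition compop (X : finType) (A B : operator X) : operator X :=
  fun x z => \sum_(y : X) A x y * B y z.

Definition tensor_power (Q : finType) (n : nat) (U : operator Q) :
    operator 'rV[Q]_n :=
  fun x y => \prod_(i < n) U (x 0 i) (y 0 i).

End Registers.

Section NormGate.
Variables (C : numClosedFieldType) (F : finFieldType).

(* (-1)^t for t in the prime field {0, 1} of a field F of characteristic 2;   *)
(* only used for such t, namely t = x ^+ 7 with x in F_8, and sums of these.  *)
Definition signF (t : F) : C := (-1) ^+ (t == 1).

Definition norm_gate : operator C F :=
  fun x y => signF (y ^+ 7) * (x == y)%:R.

End NormGate.

Section Qubits.
Variable C : numClosedFieldType.

Definition pauliX : operator C bool := fun b c => (b == ~~ c)%:R.

Definition CCZ : operator C 'rV[bool]_3 :=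
  fun x y => (-1) ^+ [forall i, y 0 i] * (x == y)%:R.

Definition X3_CCZ_X3 : operator C 'rV[bool]_3 :=
  compop (tensor_power (n := 3) pauliX)
         (compop CCZ (tensor_power (n := 3) pauliX)).

End Qubits.

(* The label in F of the three-qubit basis state |b>, for e_0, e_1, e_2 in F. *)
Definition qubit_label (F : finFieldType) (e : 'I_3 -> F) (b : 'rV[bool]_3) : F :=
  \sum_(i < 3) e i *+ b 0 i.

(* Unique expansion of every element of F as an F_2-combination of the e_i.   *)
Definition is_F2_basis (F : finFieldType) (e : 'I_3 -> F) : Prop :=
  bijective (qubit_label e).

(* The CSS code of G : the first k rows are the X-logical operators, the last *)
(* r rows generate the X-stabilizer space.                                    *)
Section CSSCode.
Variables (C : numClosedFieldType) (F : finFieldType) (k r n : nat).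
Variable G : 'M[F]_(k + r, n).

Definition logical_rows : 'M[F]_(k, n) := usubmx G.
Definition stabilizer_rows : 'M[F]_(r, n) := dsubmx G.

Definition stabilizer_space : {set 'rV[F]_n} :=
  [set g : 'rV[F]_n | (g <= stabilizer_rows)%MS].

Definition logical_ket (u : 'rV[F]_k) : state C 'rV[F]_n :=
  (sqrtC #|stabilizer_space|%:R)^-1 *:
    \sum_(g in stabilizer_space) ket C (u *m logical_rows + g).

Definition norm_gate_acts_logically : Prop :=
  forall u : 'rV[F]_k,
    applyop (tensor_power (n := n) (@norm_gate C F)) (logical_ket u) =
    signF C (\sum_(a < k) u 0 a ^+ 7) *: logical_ket u.

Definition hamming_weight (v : 'rV[F]_n) : nat := #|[set i | v 0 i != 0]|.

Definition nontrivial_Z (v : 'rV[F]_n) : Prop :=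
  (forall s : 'I_r, \sum_(i < n) stabilizer_rows s i * v 0 i = 0) /\
  (exists a : 'I_k, \sum_(i < n) logical_rows a i * v 0 i != 0).

Definition is_Z_distance (d : nat) : Prop :=
  (exists2 v : 'rV[F]_n, nontrivial_Z v & hamming_weight v = d) /\
  (forall v : 'rV[F]_n, nontrivial_Z v -> (d <= hamming_weight v)%N).

End CSSCode.

(* The exponent pair (a, b) stands for the monomial x^a y^b; pt j is the      *)
(* point (x, y) labelling column j.                                           *)
Definition monomial_mx (F : finFieldType) (m n : nat)
    (s : m.-tuple (nat * nat)) (pt : 'I_n -> F * F) : 'M[F]_(m, n) :=
  \matrix_(i < m, j < n)
    ((pt j).1 ^+ (tnth s i).1 * (pt j).2 ^+ (tnth s i).2).

Definition stab_exponents : 5.-tuple (nat * nat) :=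
  [tuple (0, 0); (1, 0); (0, 1); (2, 0); (0, 2)]%N.

Definition code_mx (F : finFieldType) (E : 8.-tuple (nat * nat))
    (pt : 'I_64 -> F * F) : 'M[F]_(8 + 5, 64) :=
  col_mx (monomial_mx E pt) (monomial_mx stab_exponents pt).

Definition E1 : 8.-tuple (nat * nat) :=
  [tuple (1, 2); (1, 5); (2, 5); (2, 6); (4, 2); (4, 6); (5, 1); (5, 5)]%N.
Definition E2 : 8.-tuple (nat * nat) :=
  [tuple (1, 3); (2, 2); (2, 4); (3, 1); (3, 4); (4, 2); (4, 3); (4, 4)]%N.
Definition E3 : 8.-tuple (nat * nat) :=
  [tuple (1, 5); (2, 1); (2, 4); (5, 1); (5, 2); (5, 5); (6, 2); (6, 4)]%N.

(* Main.v *)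
Require Import Defs.
From HB Require Import structures.
From mathcomp Require Import all_boot all_order all_algebra all_field ring.

Set Implicit Arguments.
Unset Strict Implicit.
Unset Printing Implicit Defensive.

Import GRing.Theory Num.Theory.

Local Open Scope ring_scope.

(* The sum of x^a over F_8 is 1 if a > 0 and 7 | a, and 0 otherwise, so sums  *)
(* over F_8^2 of monomials, and with them the rank and the cubic identity,    *)
(* depend only on exponents modulo 7.  Since squaring is additive, the cubic  *)
(* identity computes the sum of (w G)_i^7 = (w G)_i^4 (w G)_i^2 (w G)_i as    *)
(* that of w_a^7 over the logical rows: this is the logical action.  The      *)
(* stabilizers detect p(x) + q(y) for all p, q of degree at most 2, hence     *)
(* every nonzero vector of weight at most 3; the indicator of {0,1}^2 is      *)
(* orthogonal to all p(x) + q(y), but not to x^a y^b with a, b > 0.           *)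

(** All that matters about [E] is a finite check on exponents, because [sum_monomial8] evaluates
    every monomial sum over the plane; rank and cubic identity follow by [rank_monomial_mx] and
    [triorthogonalP]. Every ket of a logical state has a label [w *m G] with [w] extending [u], and
    [sum_mulmx_exp7] makes its phase depend on [u] alone. For the distance, an entry of [v] at a
    point isolated in one coordinate vanishes ([isolated_eq0]); among three points this leaves only
    the corner of an L, which orthogonality to the constant 1 excludes. [square01] attains the bound
    4. As gates, N negates all labels but 0, the conjugated [CCZ] only 000, so they differ by the
    phase -1. *)

Lemma expf_card_pred (F : finFieldType) (x : F) :
  x != 0 -> x ^+ #|F|.-1 = 1.
Proof.
move=> x0; apply: (mulfI x0); rewrite mulr1 -exprS prednK ?expf_card //.
by apply/card_gt0P; exists 0.
Qed.

(** Otherwise all q = [#|F|.-1] nonzero elements would be roots of unity of order [n %% q], more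
    than the degree [n %% q] allows. *)
Lemma exists_expf_neq1 (F : finFieldType) (n : nat) :
  ~~ (#|F|.-1 %| n)%N -> exists2 c : F, c != 0 & c ^+ n != 1.
Proof.
set q := #|F|.-1 => qn.
have q0 : (0 < q)%N by rewrite /q -subn1 subn_gt0 finNzRing_gt1.
have [c /andP[c0 cn]|H] := pickP [pred c : F | (c != 0) && (c ^+ n != 1)].
  by exists c.
suff : (q <= n %% q)%N by rewrite leqNgt ltn_mod q0.
have {1}-> : q = size (enum [set~ (0 : F)]) by rewrite -cardE cardsC1.
apply: max_unity_roots; [| | exact: enum_uniq].
  by rewrite lt0n.
apply/allP => c; rewrite mem_enum !inE => c0.
have := H c; rewrite /= c0 /= => /negbFE; rewrite {1}(divn_eq n q) unity_rootE.
by rewrite exprD mulnC exprM expf_card_pred // expr1n mul1r.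
Qed.

(** If q does not divide [n], the substitution of [c * x] for [x] multiplies the sum by some
    [c ^+ n != 1], so it vanishes. *)
Lemma sum_expf (F : finFieldType) (n : nat) :
  \sum_(x : F) x ^+ n = if (0 < n)%N && (#|F|.-1 %| n)%N then -1 else 0.
Proof.
(* Translating by 1 permutes F and adds [#|F|] to the sum of all elements. *)
have card0 : #|F|%:R = 0 :> F.
  apply/(addrI (\sum_(x : F) x)); rewrite addr0 [RHS](reindex_inj (addIr 1)).
  by rewrite big_split sumr_const.
have [->|n0] := posnP n.
  by rewrite (eq_bigr (fun=> 1)) ?sumr_const.
have q0 : (0 < #|F|)%N by apply/card_gt0P; exists 0.
case: ifPn => [dvd|/exists_expf_neq1[c c0 cn]].
  rewrite (bigD1 0) //= expr0n gtn_eqF // add0r (eq_bigr (fun=> 1)); last first.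
    by move=> x x0; rewrite -(divnK dvd) mulnC exprM expf_card_pred ?expr1n.
  by rewrite sumr_const cardC1 -subn1 natrB // card0 sub0r.
apply/eqP; rewrite -(inj_eq (mulfI (_ : c ^+ n - 1 != 0))) ?subr_eq0 // mulr0.
rewrite mulrBl mul1r subr_eq0 mulr_sumr [eqbRHS](reindex_inj (mulfI c0)).
by apply/eqP/eq_bigr => x _; rewrite exprMn.
Qed.

Lemma expf7 (F : finFieldType) (x : F) : #|F| = 8 -> x ^+ 7 = (x != 0)%:R.
Proof.
move=> F8; have [->|x0] := eqVneq x 0; first by rewrite expr0n.
by have := expf_card_pred x0; rewrite F8.
Qed.

Lemma pchar_card8 (F : finFieldType) : #|F| = 8 -> 2 \in [pchar F].
Proof. by move=> F8; apply: (card_finPcharP (n := 3)). Qed.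

(** * Monomial sums over the plane F_8^2 *)

Section PowerSums.

Variables (F : finFieldType) (hF : #|F| = 8) (n : nat) (pt : 'I_n -> F * F).
Hypothesis hpt : bijective pt.

Lemma sum_coord_mul (f g : F -> F) :
  \sum_(i < n) f (pt i).1 * g (pt i).2 = (\sum_x f x) * (\sum_y g y).
Proof.
rewrite big_distrlr pair_big /= [RHS](reindex pt) //.
exact: onW_bij.
Qed.

(** The exponents with nonzero power sum over F_8; 0 is excluded because [0 ^+ 0 = 1]. *)
Definition pos_mul7 (a : nat) := (0 < a)%N && (7 %| a)%N.

Lemma sum_monomial8 (a b : nat) :
  \sum_(i < n) (pt i).1 ^+ a * (pt i).2 ^+ b = (pos_mul7 a && pos_mul7 b)%:R.
Proof.
rewrite (sum_coord_mul (fun x => x ^+ a) (fun y => y ^+ b)).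
rewrite !sum_expf hF /pos_mul7.
by do 2!case: ifP => _; rewrite ?mulrNN ?mulr0 ?mul0r ?mulr1.
Qed.

(* The evaluations of x^(7 - a) y^(7 - b) are dual to those of x^a y^b. *)
Lemma rank_monomial_mx (m : nat) (s : m.-tuple (nat * nat)) :
  uniq s -> all (fun e => (e.1 < 7)%N && (e.2 < 7)%N) s ->
  \rank (monomial_mx s pt) = m.
Proof.
move=> /tuple_uniqP s_inj /all_tnthP s_lt.
pose s' := [tuple of map (fun e : nat * nat => (7 - e.1, 7 - e.2)%N) s].
have dual : monomial_mx s pt *m (monomial_mx s' pt)^T = 1%:M.
  apply/matrixP => i j; rewrite !mxE.
  under eq_bigr => l _ do
    rewrite !mxE !tnth_map /= mulrACA -!exprD.
  rewrite sum_monomial8; congr (_%:R); rewrite -(inj_eq s_inj) -pair_eqE /=.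
  (* Here [a + (7 - b)] lies between 1 and 13, so 7 is the only multiple of 7 it can equal. *)
  have pos_mul7E a b :
      (a < 7)%N -> (b < 7)%N -> pos_mul7 (a + (7 - b)) = (a == b).
    by case: a => [|[|[|[|[|[|[|a]]]]]]] // _;
      case: b => [|[|[|[|[|[|[|b]]]]]]].
  have /andP[i1 i2] := s_lt i; have /andP[j1 j2] := s_lt j.
  by rewrite !pos_mul7E.
apply/eqP; rewrite eqn_leq rank_leq_row /= -{1}(mxrank1 F m) -dual.
exact: mxrankM_maxl.
Qed.

(** The cubic identity read on exponents, over natural-number indices so that it can be decided by
    computation. *)
Definition triorthogonal (k : nat) (s : seq (nat * nat)) : bool :=
  let r := iota 0 (size s) in
  let e f a b c := (f (nth (0, 0) s a) * 4 + f (nth (0, 0) s b) * 2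
                    + f (nth (0, 0) s c))%N in
  all (fun a => all (fun b => all (fun c =>
    pos_mul7 (e fst a b c) && pos_mul7 (e snd a b c)
      == [&& a == b, b == c & (a < k)%N]) r) r) r.

Lemma triorthogonalP (m k : nat) (s : m.-tuple (nat * nat)) (a b c : 'I_m) :
  triorthogonal k s ->
  \sum_(i < n) monomial_mx s pt a i ^+ 4 * monomial_mx s pt b i ^+ 2
     * monomial_mx s pt c i
  = if [&& a == b, b == c & (a < k)%N] then 1 else 0.
Proof.
have mul2ACA (u v w x y z : F) :
    u * v * (w * x) * (y * z) = u * w * y * (v * x * z).
  by rewrite (mulrACA u) [LHS]mulrACA.
have ord_iota (l : 'I_m) : (l : nat) \in iota 0 (size s).
  by rewrite mem_iota size_tuple add0n ltn_ord.
move=> /allP/(_ _ (ord_iota a))/allP/(_ _ (ord_iota b)).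
move=> /allP/(_ _ (ord_iota c))/eqP <-.
under eq_bigr => l _.
  by rewrite !mxE !exprMn -!exprM mul2ACA -!exprD over.
rewrite sum_monomial8 !(tnth_nth (0, 0)%N).
by case: (_ && _).
Qed.

Lemma sum_exp01 (a : nat) :
  \sum_(x : F) x ^+ a * (x \in [set 0; 1])%:R = (0 < a)%:R.
Proof.
rewrite (bigD1 0) // (bigD1 1) ?oner_eq0 //= big1 => [|x /andP[x0 x1]].
  rewrite !inE !eqxx orbT !mulr1 expr1n addr0 expr0n.
  (* For [a = 0] both points contribute, and 1 + 1 = 0. *)
  by case: a => [|a] /=; rewrite ?add0r // addrr_pchar2 ?pchar_card8.
by rewrite !inE (negPf x0) (negPf x1) mulr0.
Qed.

Definition square01 : 'rV[F]_n :=
  \row_i (((pt i).1 \in [set 0; 1]) && ((pt i).2 \in [set 0; 1]))%:R.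

Lemma sum_square01 (m : nat) (s : m.-tuple (nat * nat)) (a : 'I_m) :
  \sum_i monomial_mx s pt a i * square01 0 i =
  ((0 < (tnth s a).1)%N && (0 < (tnth s a).2)%N)%:R.
Proof.
rewrite -mulnb natrM -!sum_exp01 -sum_coord_mul; apply: eq_bigr => i _.
by rewrite !mxE -mulnb natrM mulrACA.
Qed.

Lemma weight_square01 : hamming_weight square01 = 4.
Proof.
have -> : 4 = #|setX [set (0 : F); 1] [set (0 : F); 1]|.
  by rewrite cardsX cards2 eq_sym oner_eq0.
rewrite -(on_card_preimset (onW_bij _ hpt)); apply: eq_card => i.
by rewrite !inE mxE !inE; case: (_ && _); rewrite ?oner_eq0 ?eqxx.
Qed.

End PowerSums.

(** * From the cubic identity to the logical action *)

Section LogicalAction.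

Variables (C : numClosedFieldType) (F : finFieldType) (hF : #|F| = 8).

Lemma sum_exp2n (I : finType) (f : I -> F) (m : nat) :
  (\sum_i f i) ^+ (2 ^ m) = \sum_i f i ^+ (2 ^ m).
Proof.
elim: m => [|m IHm] //; rewrite expnSr exprM IHm.
rewrite -(pFrobenius_autE (pchar_card8 hF)) rmorph_sum.
by apply: eq_bigr => i _; rewrite exprM -(pFrobenius_autE (pchar_card8 hF)).
Qed.

Lemma sum_mulmx_exp7 (m n k : nat) (G : 'M[F]_(m, n)) (w : 'rV[F]_m) :
  (forall a b c : 'I_m,
     \sum_(i < n) G a i ^+ 4 * G b i ^+ 2 * G c i =
     if [&& a == b, b == c & (a < k)%N] then 1 else 0) ->
  \sum_(i < n) (w *m G) 0 i ^+ 7 = \sum_(a < m | (a < k)%N) w 0 a ^+ 7.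
Proof.
move=> triG.
transitivity (\sum_(i < n) \sum_a \sum_b \sum_c
  (w 0 a ^+ 4 * w 0 b ^+ 2 * w 0 c) * (G a i ^+ 4 * G b i ^+ 2 * G c i)).
  (* Writing 7 = 4 + 2 + 1, the Frobenius powers distribute over the sum and leave a trilinear
     expansion. *)
  apply: eq_bigr => i _; rewrite mxE (exprD _ 6 1) (exprD _ 4 2) expr1.
  rewrite (sum_exp2n _ 2) (sum_exp2n _ 1) big_distrlr /= mulr_suml.
  apply: eq_bigr => a _; rewrite mulr_suml; apply: eq_bigr => b _.
  rewrite mulr_sumr; apply: eq_bigr => c _.
  by rewrite !exprMn [RHS]mulrACA [X in _ = X * _]mulrACA mulrA.
rewrite exchange_big [RHS]big_mkcond; apply: eq_bigr => a _.
rewrite exchange_big (bigD1 a) //= [X in _ + X]big1 ?addr0 => [|b ba].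
  rewrite exchange_big (bigD1 a) //= [X in _ + X]big1 ?addr0 => [|c ca].
    rewrite -mulr_sumr triG eqxx /=; case: ifP => _; last by rewrite mulr0.
    by rewrite mulr1 -exprD -exprSr.
  by rewrite -mulr_sumr triG (eq_sym a c) (negPf ca) andbF mulr0.
rewrite exchange_big big1 // => c _.
by rewrite -mulr_sumr triG (eq_sym a b) (negPf ba) mulr0.
Qed.

(** [signF] is multiplicative only on the prime field, so the induction also carries a boolean
    witnessing that the partial sum stays there. *)
Lemma prod_signF (n : nat) (t : 'I_n -> bool) :
  \prod_i signF C ((t i)%:R : F) = signF C (\sum_i (t i)%:R : F).
Proof.
suff [b -> ->] : exists2 b : bool, \sum_i (t i)%:R = b%:R :> F
    & \prod_i signF C ((t i)%:R : F) = signF C (b%:R : F) by [].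
apply: (big_rec2 (fun x y => exists2 b : bool, y = b%:R & x = signF C b%:R)).
  by exists false; rewrite // /signF eq_sym oner_eq0.
move=> i x y _ [b -> ->]; exists (t i (+) b).
  by case: (t i); case: b; rewrite ?add0r ?addr0 // addrr_pchar2 ?pchar_card8.
rewrite /signF; case: (t i); case: b; rewrite /= ?eqxx [0 == 1]eq_sym oner_eq0;
by rewrite ?mulr1 ?mul1r ?mulrNN ?mul1r.
Qed.

Lemma apply_norm_gates (n : nat) (psi : state C 'rV[F]_n) (x : 'rV[F]_n) :
  applyop (tensor_power (n := n) (@norm_gate C F)) psi x =
  signF C (\sum_i x 0 i ^+ 7) * psi x.
Proof.
rewrite ffunE (bigD1 x) //= [X in _ + X]big1 ?addr0 => [|y yx].
  congr (_ * _); under [in RHS]eq_bigr => i _ do rewrite expf7 //.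
  rewrite -prod_signF; apply: eq_bigr => i _.
  by rewrite /norm_gate eqxx mulr1 expf7.
have [i yxi] : exists i, x 0 i != y 0 i.
  apply/existsP; apply: contraNT yx; rewrite negb_exists => /forallP xy.
  by apply/eqP/rowP => i; have /negPn/eqP := xy i.
by rewrite /tensor_power (bigD1 i) //= /norm_gate (negPf yxi) mulr0 !mul0r.
Qed.

Lemma triorthogonal_acts_logically (k r n : nat) (G : 'M[F]_(k + r, n)) :
  (forall a b c : 'I_(k + r),
     \sum_(i < n) G a i ^+ 4 * G b i ^+ 2 * G c i =
     if [&& a == b, b == c & (a < k)%N] then 1 else 0) ->
  norm_gate_acts_logically C G.
Proof.
move=> triG u; apply/ffunP => x; rewrite apply_norm_gates !ffunE !sum_ffunE.
rewrite /GRing.scale /= mulrCA [RHS]mulrCA.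
congr (_ * _); rewrite !mulr_sumr; apply: eq_bigr => g.
rewrite inE ffunE => /submxP[z ->]; case: eqP => [->|_]; last by rewrite !mulr0.
(* The label is now [row_mx u z *m G]; only its first [k] coefficients, those of [u], enter the
   phase. *)
rewrite !mulr1 /logical_rows /stabilizer_rows -mul_row_col vsubmxK.
congr signF; rewrite (sum_mulmx_exp7 _ triG) big_split_ord /=.
rewrite [X in _ + X]big_pred0 ?addr0 => [|j]; last by rewrite ltnNge leq_addr.
by apply: eq_big => a; rewrite ?ltn_ord // row_mxEl.
Qed.

End LogicalAction.

(** * Lower bound on the Z-distance *)

Section Distance.

Variables (F : finFieldType) (n : nat) (pt : 'I_n -> F * F).

(* Pair v with the test function (f - f_j) (f - f_k). *)
Lemma isolated_eq0 (f : 'I_n -> F) (v : 'rV[F]_n) (i j k : 'I_n) :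
  (forall d, (d < 3)%N -> \sum_l f l ^+ d * v 0 l = 0) ->
  (forall l, v 0 l != 0 -> l \in [:: i; j; k]) ->
  f j != f i -> f k != f i -> v 0 i = 0.
Proof.
move=> f_orth v_supp fji fki.
have : \sum_l (f l - f j) * (f l - f k) * v 0 l = 0.
  transitivity (\sum_l f l ^+ 2 * v 0 l - (f j + f k) * \sum_l f l ^+ 1 * v 0 l
                + f j * f k * \sum_l f l ^+ 0 * v 0 l).
    rewrite !mulr_sumr -sumrB -big_split; apply: eq_bigr => l _ /=.
    by ring.
  by rewrite !f_orth // !mulr0 subr0 addr0.
rewrite (bigD1 i) //= [X in _ + X]big1 ?addr0 => [/eqP|l li].
  rewrite !mulf_eq0 !subr_eq0 !(eq_sym (f i)).
  by rewrite (negPf fji) (negPf fki) => /eqP.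
have [->|/v_supp] := eqVneq (v 0 l) 0; first by rewrite mulr0.
by rewrite !inE (negPf li) /= => /orP[]/eqP->; rewrite subrr ?mulr0 !mul0r.
Qed.

Hypothesis pt_inj : injective pt.

Lemma stabilizer_orthogonal_weight (v : 'rV[F]_n) :
  (3 <= n)%N ->
  (forall s, \sum_j monomial_mx stab_exponents pt s j * v 0 j = 0) ->
  v != 0 -> (4 <= hamming_weight v)%N.
Proof.
move=> n3 v_orth; apply: contraNT; rewrite -ltnNge ltnS => wt_v.
have orth t : t \in stab_exponents ->
    \sum_j (pt j).1 ^+ t.1 * (pt j).2 ^+ t.2 * v 0 j = 0.
  case/tnthP => s ->; rewrite -[RHS](v_orth s).
  by apply: eq_bigr => j _; rewrite mxE.
have orth1 d : (d < 3)%N -> \sum_j (pt j).1 ^+ d * v 0 j = 0.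
  move=> d3; rewrite -{}[RHS](orth (d, 0)%N) /=; last by case: d d3 => [|[|[]]].
  by apply: eq_bigr => j _; rewrite mulr1.
have orth2 d : (d < 3)%N -> \sum_j (pt j).2 ^+ d * v 0 j = 0.
  move=> d3; rewrite -{}[RHS](orth (0, d)%N) /=; last by case: d d3 => [|[|[]]].
  by apply: eq_bigr => j _; rewrite mul1r.
set S := [set i | v 0 i != 0] in wt_v.
(* The support is padded to three distinct indices by zeros of [v], which is possible since
   [3 <= n]. *)
have [i [j [k [ij ik jk v_supp]]]] : exists i j k,
    [/\ i != j, i != k, j != k & forall l, v 0 l != 0 -> l \in [:: i; j; k]].
  have : uniq (take 3 (enum S ++ enum (~: S))).
    rewrite take_uniq // cat_uniq !enum_uniq andbT /=; apply/hasPn => l.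
    by rewrite !mem_enum inE.
  have : {subset S <= take 3 (enum S ++ enum (~: S))}.
    move=> l lS; rewrite take_cat -cardE ltnNge wt_v /= mem_cat mem_enum lS //.
  have : size (take 3 (enum S ++ enum (~: S))) = 3.
    by rewrite size_takel // size_cat -!cardE cardsC card_ord.
  case: (take _ _) => [|i [|j [|k []]]] //= _ v_supp.
  rewrite !inE negb_or andbT => /andP[/andP[ij ik] jk].
  by exists i, j, k; split=> // l vl; apply: v_supp; rewrite inE.
(* If [a] shares [f] with [b] and [g] with [c], then [c] is isolated for [f] and [b] for [g]. Their
   entries vanish, and pairing with the constant 1 leaves [v 0 a = 0]. *)
have corner (f g : 'I_n -> F) (a b c : 'I_n) :
    (forall d, (d < 3)%N -> \sum_l f l ^+ d * v 0 l = 0) ->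
    (forall d, (d < 3)%N -> \sum_l g l ^+ d * v 0 l = 0) ->
    (forall l l', f l = f l' -> g l = g l' -> l = l') ->
    a != b -> a != c -> b != c ->
    (forall l, v 0 l != 0 -> l \in [:: a; b; c]) ->
    f b = f a -> v 0 a = 0.
  move=> f_orth g_orth fg_inj ab ac bc supp fba.
  have gba : g b != g a by apply: contraNneq ab => /(fg_inj _ _ fba) ->.
  have [gca|gca] := eqVneq (g c) (g a); last first.
    exact: (isolated_eq0 g_orth supp).
  have fca : f c != f a by apply: contraNneq ac => /fg_inj/(_ gca) ->.
  have vc : v 0 c = 0.
    apply: (isolated_eq0 (j := a) (k := b) f_orth) => [l /supp||].
    - by rewrite !inE => /or3P[]->; rewrite ?orbT.
    - by rewrite eq_sym.
    - by rewrite fba eq_sym.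
  have vb : v 0 b = 0.
    apply: (isolated_eq0 (j := a) (k := c) g_orth) => [l /supp||].
    - by rewrite !inE => /or3P[]->; rewrite ?orbT.
    - by rewrite eq_sym.
    - by rewrite gca eq_sym.
  have := f_orth 0%N isT; rewrite (bigD1 a) //= big1 ?addr0 ?mul1r // => l la.
  have [->|/supp] := eqVneq (v 0 l) 0; first by rewrite mulr0.
  by rewrite !inE (negPf la) /= => /orP[]/eqP->; rewrite ?vb ?vc mulr0.
have inj12 l l' : (pt l).1 = (pt l').1 -> (pt l).2 = (pt l').2 -> l = l'.
  by move=> e1 e2; apply: pt_inj; apply/eqP; rewrite -pair_eqE /= e1 e2 !eqxx.
have vanish a b c : a != b -> a != c -> b != c ->
    (forall l, v 0 l != 0 -> l \in [:: a; b; c]) -> v 0 a = 0.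
  move=> ab ac bc supp.
  have [ba|ba] := eqVneq (pt b).1 (pt a).1.
    exact: (corner (fst \o pt) (snd \o pt) a b c).
  have [ca|ca] := eqVneq (pt c).1 (pt a).1.
    apply: (corner (fst \o pt) (snd \o pt) a c b) => //.
      by rewrite eq_sym.
    by move=> l /supp; rewrite !inE => /or3P[]->; rewrite ?orbT.
  exact: (isolated_eq0 (f := fst \o pt) orth1 supp).
apply/eqP/rowP => l; rewrite mxE; apply/eqP; apply/negPn/negP => vl.
have := v_supp l vl; rewrite !inE => /or3P[]/eqP el; case/eqP: vl; rewrite {}el.
- exact: (vanish i j k).
- by apply: (vanish j i k) => //; first rewrite eq_sym //;
    move=> m /v_supp; rewrite !inE => /or3P[]->; rewrite ?orbT.
- by apply: (vanish k i j) => //; rewrite 1?eq_sym //;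
    move=> m /v_supp; rewrite !inE => /or3P[]->; rewrite ?orbT.
Qed.

End Distance.

(** * The norm gate on three qubits *)

Section Gate.

Variable C : numClosedFieldType.

Lemma pauliX3E (x y : 'rV[bool]_3) :
  tensor_power (n := 3) (pauliX C) x y = (x == map_mx negb y)%:R.
Proof.
have [->|xy] := eqVneq.
  by rewrite /tensor_power big1 // => i _; rewrite /pauliX mxE eqxx.
have [i xyi] : exists i, x 0 i != ~~ y 0 i.
  apply/existsP; apply: contraNT xy; rewrite negb_exists => /forallP xy.
  by apply/eqP/rowP => i; rewrite mxE; have /negPn/eqP := xy i.
by rewrite /tensor_power (bigD1 i) //= /pauliX (negPf xyi) mul0r.
Qed.

(** Conjugation by bit flips moves the sign of [CCZ] from 111 to 000. *)
Lemma X3_CCZ_X3E (x y : 'rV[bool]_3) :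
  X3_CCZ_X3 C x y = (-1) ^+ (y == const_mx false) * (x == y)%:R.
Proof.
have negK : involutive (map_mx negb : 'rV[bool]_3 -> 'rV[bool]_3).
  by move=> z; apply/rowP => i; rewrite !mxE negbK.
set ny := map_mx negb y.
have inner z : compop (CCZ C) (tensor_power (n := 3) (pauliX C)) z y =
    CCZ C z ny.
  rewrite /compop (bigD1 ny) //= pauliX3E eqxx mulr1 big1 ?addr0 // => z' z'y.
  by rewrite pauliX3E (negPf z'y) mulr0.
rewrite /X3_CCZ_X3 {1}/compop (bigD1 ny) //= big1 ?addr0 => [|z zy].
  rewrite inner pauliX3E negK /CCZ eqxx mulr1 mulrC.
  congr ((-1) ^+ nat_of_bool _ * _).
  rewrite /ny; apply/forallP/eqP => [y0|-> i]; last by rewrite !mxE.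
  by apply/rowP => i; have := y0 i; rewrite !mxE => /negPf.
by rewrite inner /CCZ (negPf zy) !mulr0.
Qed.

Lemma norm_gate_X3_CCZ_X3 (F : finFieldType) (e : 'I_3 -> F)
    (x y : 'rV[bool]_3) :
  #|F| = 8 -> is_F2_basis e ->
  norm_gate C (qubit_label e x) (qubit_label e y) = - X3_CCZ_X3 C x y.
Proof.
move=> hF /bij_inj e_inj.
have label0 : qubit_label e (const_mx false) = 0.
  by apply: big1 => i _; rewrite mxE mulr0n.
rewrite X3_CCZ_X3E /norm_gate (inj_eq e_inj) -mulNr; congr (_ * _).
rewrite expf7 // -label0 (inj_eq e_inj) /signF.
by case: (y == _); rewrite /= ?eqxx ?opprK // eq_sym oner_eq0.
Qed.

End Gate.

(** * The three codes *)

Lemma code_mxE (F : finFieldType) (E : 8.-tuple (nat * nat))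
    (pt : 'I_64 -> F * F) :
  code_mx E pt = monomial_mx [tuple of E ++ stab_exponents] pt.
Proof.
apply/matrixP => i j; case: (split_ordP i) => a ->.
  by rewrite col_mxEu !mxE tnth_lshift.
by rewrite col_mxEd !mxE tnth_rshift.
Qed.

Theorem mainTheorem10 (C : numClosedFieldType) (F : finFieldType)
    (hF : #|F| = 8%N)
    (pt : 'I_64 -> F * F) (hpt : bijective pt)
    (E : 8.-tuple (nat * nat)) (hE : E = E1 \/ E = E2 \/ E = E3) :
  let G : 'M[F]_(8 + 5, 64) := code_mx E pt in
  [/\ \rank G = 13%N,
      forall a b c : 'I_(8 + 5),
        \sum_(i < 64) (G a i) ^+ 4 * (G b i) ^+ 2 * G c i =
        (if [&& a == b, b == c & (a < 8)%N] then 1 else 0),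
      norm_gate_acts_logically C G,
      is_Z_distance G 4
    & forall e : 'I_3 -> F, is_F2_basis e ->
        exists2 w : C, `|w| = 1 &
          forall x y : 'rV[bool]_3,
            norm_gate C (qubit_label e x) (qubit_label e y) =
            w * X3_CCZ_X3 C x y].
Proof.
move=> G; pose s := [tuple of E ++ stab_exponents].
(* These four checks are all that is used about the three exponent sets. *)
have [s_uniq s_lt s_tri E_gt0] : [/\ uniq s,
    all (fun e => (e.1 < 7)%N && (e.2 < 7)%N) s, triorthogonal 8 s
    & all (fun e => (0 < e.1)%N && (0 < e.2)%N) E].
  by rewrite /s; case: hE => [->|[]->]; split; vm_compute.
have triG (a b c : 'I_(8 + 5)) :
    \sum_(i < 64) (G a i) ^+ 4 * (G b i) ^+ 2 * G c i =
    if [&& a == b, b == c & (a < 8)%N] then 1 else 0.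
  by rewrite /G code_mxE; apply: (triorthogonalP hF hpt).
split=> //.
- by rewrite /G code_mxE (rank_monomial_mx hF hpt).
- exact: triorthogonal_acts_logically.
- rewrite /is_Z_distance /nontrivial_Z /stabilizer_rows /logical_rows.
  rewrite col_mxKu col_mxKd; split.
    exists (square01 pt); last exact: weight_square01.
    split=> [i|]; rewrite ?(sum_square01 hF hpt).
      have : tnth stab_exponents i \in stab_exponents by apply: mem_tnth.
      by rewrite !inE => /or4P[||| /orP[]] /eqP->.
    (* Any logical row would serve, as all its exponents are positive. *)
    exists ord0; rewrite (sum_square01 hF hpt).
    by rewrite (all_tnthP E_gt0 ord0) oner_eq0.
  move=> v [v_orth [a va]].
  apply: (stabilizer_orthogonal_weight (bij_inj hpt) _ v_orth) => //.
  apply: contraNneq va => ->; rewrite big1 // => i _.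
  by rewrite [X in _ * X]mxE mulr0.
- move=> e e_basis; exists (-1); first by rewrite normrN1.
  by move=> x y; rewrite mulN1r norm_gate_X3_CCZ_X3.
Qed.
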